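(* For an integer $s\ge 1$, the problem $\mathrm{DYCK}(s)$ is $\lceil\log s\rceil$-streaming reducible to $\mathrm{DYCK}(2)$ with space and time $O(\log s)$.
   Context: Logarithms are base $2$. For an integer $s\ge1$, $\mathrm{DYCK}(s)$ is the language of well-parenthesized words with $s$ types of parentheses: over the alphabet $\{a_1,\bar a_1,\ldots,a_s,\bar a_s\}$ it is the smallest language $L$ satisfying $L=\{\epsilon\}\cup\bigcup_{i=1}^s a_iL\bar a_iL$. $\mathrm{DYCK}(s)$ also denotes the problem of deciding whether a given word is in the language. Streaming reduction: let $\Sigma_1,\Sigma_2$ be alphabets. A problem $P_1$ (on words over $\Sigma_1$) is $f(n)$-streaming reducible to a problem $P_2$ (on words over $\Sigma_2$) with space $\sigma(n)$ and time $t(n)$ if for every input $x=x_1\ldots x_n\in\Sigma_1^n$ there exists $y=y_1y_2\ldots y_n$ with each $y_i\in\Sigma_2^{f(n)}$ such that: (1) $y_i$ can be computed deterministically from $x_i$ using space $\sigma(n)$ and time $t(n)$; (2) from a solution of $P_2$ with input $y$, a solution of $P_1$ with input $x$ can be computed with space $\sigma(n)$ and time $t(n)$.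
   Formalization: For s = 1 the block length ⌈log s⌉ = 0 is replaced by 1 and the space and time bounds O(log s) = 0 by some finite bound, since empty blocks send every input to the empty word and the claim is false there; nothing changes for s ≥ 2. *)

(* Defs.v *)
From HB Require Import structures.
From mathcomp Require Import all_boot.
Set Implicit Arguments.
Unset Strict Implicit.
Unset Printing Implicit Defensive.

Definition bigO (g h : nat -> nat) : Prop :=
  exists C m0 : nat, forall m, m0 <= m -> g m <= C * h m.

(** Computation model: a deterministic Turing machine with a one-way read-only
    input tape, a write-only output tape and finitely many two-way infinite work
    tapes over {blank, 0, 1}. Time is the number of steps, space the number of
    work-tape cells visited. The input being read only once, a machine has to
    pay for whatever part of it it remembers. *)

(* [lhs] is listed from the head outwards; all cells that are not listed are
   blank and have never been visited. *)
Record tape := Tape {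
  lhs : seq (option bool);
  cur : option bool;
  rhs : seq (option bool) }.

Definition blank_tape : tape := Tape [::] None [::].

Definition tape_space (t : tape) : nat := size (lhs t) + 1 + size (rhs t).

Inductive move := MoveLeft | Stay | MoveRight.

Definition tape_act (a : option bool * move) (t : tape) : tape :=
  let: (c, m) := a in
  match m with
  | MoveLeft => Tape (behead (lhs t)) (head None (lhs t)) (c :: rhs t)
  | Stay => Tape (lhs t) c (rhs t)
  | MoveRight => Tape (c :: lhs t) (head None (rhs t)) (behead (rhs t))
  end.

Record action (Q : Type) (k : nat) := Action {
  next_state : Q;
  advance : bool;
  emit : option bool;
  work_act : 'I_k -> option bool * move }.

(* The state set is finite and fixed, and so is the number of work tapes. In
   [trans q c w], [c] is the input bit under the head, [None] once the input is
   exhausted, and [w] gives the scanned work symbols; the machine halts when the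
   result is [None]. *)
Record machine := Machine {
  state : finType;
  start : state;
  tapes : nat;
  trans : state -> option bool -> {ffun 'I_tapes -> option bool} ->
          option (action state tapes) }.

Record config (M : machine) := Config {
  cstate : state M;
  unread : seq bool;
  written : seq bool;
  work : {ffun 'I_(tapes M) -> tape} }.

Definition start_config (M : machine) (w : seq bool) : config M :=
  Config (start M) w [::] [ffun=> blank_tape].

Definition next_action (M : machine) (c : config M) :
    option (action (state M) (tapes M)) :=
  trans (cstate c) (ohead (unread c)) [ffun i => cur (work c i)].

Definition halted (M : machine) (c : config M) : Prop := next_action c = None.

Definition step (M : machine) (c : config M) : config M :=
  if next_action c is Some a then
    Config (next_state a)
           (if advance a then behead (unread c) else unread c)
           (if emit a is Some b then rcons (written c) b else written c)
           [ffun i => tape_act (work_act a i) (work c i)]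
  else c.

Definition config_space (M : machine) (c : config M) : nat :=
  \sum_(i < tapes M) tape_space (work c i).

Definition computes (M : machine) (w u : seq bool) (sp tm : nat) : Prop :=
  exists j : nat,
    let run i := iter i (@step M) (start_config M w) in
    [/\ j <= tm, halted (run j), written (run j) = u
      & forall i, i <= j -> config_space (run i) <= sp].

(** Decision problems, over an alphabet with a fixed-width binary code (through
    which machines read and write letters). *)
Record problem := Problem {
  letter : finType;
  width : nat;
  code : letter -> width.-tuple bool;
  code_inj : injective code;
  lang : seq letter -> Prop }.

Definition code_word (P : problem) (w : seq (letter P)) : seq bool :=
  flatten [seq tval (code a) | a <- w].

Definition is_solution (P : problem) (w : seq (letter P)) (b : bool) : Prop :=
  b <-> lang w.

(** [M] computes the blocks, [N] translates the answers. The machines are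
    parameters, so that a statement about a family of problems can ask for the
    same machines throughout: were they allowed to vary with the problem, memory
    could be hidden in the size of the finite control. *)
Definition streaming_reduction (M N : machine) (P1 P2 : problem)
    (f sigma t : nat -> nat) : Prop :=
  forall (n : nat) (x : n.-tuple (letter P1)),
  exists y : n.-tuple ((f n).-tuple (letter P2)),
    (forall i : 'I_n,
       computes M (code (tnth x i)) (code_word (tnth y i)) (sigma n) (t n)) /\
    (forall b2 : bool,
       is_solution (flatten [seq tval v | v <- y]) b2 ->
       exists2 b1 : bool, is_solution x b1
                        & computes N [:: b2] [:: b1] (sigma n) (t n)).

(* [(false, i)] is the opening and [(true, i)] the closing parenthesis of
   type [i]. *)
Definition paren (s : nat) : finType := (bool * 'I_s)%type.

Inductive dyck (s : nat) : seq (paren s) -> Prop :=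
| dyck_nil : dyck [::]
| dyck_node (i : 'I_s) (u v : seq (paren s)) :
    dyck u -> dyck v -> dyck ((false, i) :: u ++ (true, i) :: v).

(* Binary expansion of [i] on [w] bits, least significant bit first. *)
Definition bits (w i : nat) : seq bool := mkseq (fun j => odd (i %/ 2 ^ j)) w.

Lemma size_bits w i : size (bits w i) == w.
Proof. by rewrite size_mkseq. Qed.

Lemma bitsS w i : bits w.+1 i = odd i :: bits w i./2.
Proof.
rewrite /bits /mkseq /= expn0 divn1 (iotaDl 1 0) -map_comp; congr (_ :: _).
by apply: eq_map => j /=; rewrite expnS divnMA divn2.
Qed.

Lemma bits_inj w i j : i < 2 ^ w -> j < 2 ^ w -> bits w i = bits w j -> i = j.
Proof.
elim: w i j => [|w IHw] i j; first by rewrite expn0 !ltnS !leqn0 => /eqP-> /eqP->.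
have half_lt k : k < 2 ^ w.+1 -> k./2 < 2 ^ w.
  by rewrite expnS -divn2 ltn_divLR // mulnC.
move=> /half_lt lti /half_lt ltj; rewrite !bitsS => -[eq_odd /(IHw _ _ lti ltj) eq_half].
by rewrite -(odd_double_half i) -(odd_double_half j) eq_odd eq_half.
Qed.

(* [up_log 2 s] is the ceiling of the binary logarithm of [s]. *)
Definition paren_code (s : nat) (a : paren s) : (up_log 2 s).+1.-tuple bool :=
  [tuple of a.1 :: Tuple (size_bits (up_log 2 s) a.2)].

Lemma paren_code_inj s : injective (@paren_code s).
Proof.
move=> [b i] [c j] /(congr1 val) /= [-> eq_bits].
have lt_s (k : 'I_s) : k < 2 ^ up_log 2 s := leq_trans (ltn_ord k) (@up_logP 2 s isT).
by congr pair; apply: val_inj; apply: bits_inj eq_bits.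
Qed.

Definition DYCK (s : nat) : problem :=
  Problem (@paren_code_inj s) (@dyck s).

(* The ceiling of [log s], except that the value [0] at [s = 1] is replaced by
   [1]: blocks of length [0] carry no information, so that no reduction from
   [DYCK 1] can use them. *)
Definition block_length (s : nat) : nat := maxn 1 (up_log 2 s).

(* Main.v *)
(** A parenthesis of type [i] is replaced by the word of parentheses spelled by
    the binary code of [i], in reverse order for a closing parenthesis. A stack
    holding types then becomes a stack holding their codes, top bit last; codes
    are nonempty, pairwise distinct and of equal length, so popping a code
    succeeds exactly when popping its type does. An opening block is emitted
    while its code is read; a closing block needs one work tape, on which the
    code is stored before it is emitted backwards. *)
Require Import Defs.
From HB Require Import structures.
From mathcomp Require Import all_boot zify.
Set Implicit Arguments.
Unset Strict Implicit.
Unset Printing Implicit Defensive.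

(** * Stack recognition of Dyck words *)

Fixpoint balanced (T : eqType) (st : seq T) (w : seq (bool * T)) : bool :=
  match w with
  | [::] => nilp st
  | (false, i) :: w' => balanced (i :: st) w'
  | (true, i) :: w' =>
      if st is j :: st' then (j == i) && balanced st' w' else false
  end.

Lemma balanced_dyck_cat s (u : seq (paren s)) st w :
  dyck u -> balanced st (u ++ w) = balanced st w.
Proof.
move=> du; elim: du st w => //= i u1 u2 _ IH1 _ IH2 st w.
by rewrite -catA IH1 /= eqxx IH2.
Qed.

(** Extends [dyck] to a stack of pending types, so that the induction on [w] in [balanced_closes]
    goes through. *)
Fixpoint closes s (st : seq 'I_s) (w : seq (paren s)) : Prop :=
  if st is i :: st' then
    exists u v, [/\ dyck u, w = u ++ (true, i) :: v & closes st' v]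
  else dyck w.

(** On an empty stack this is [dyck_node]; otherwise the new node is absorbed into the Dyck word
    before the next pending closing. *)
Lemma closes_node s (i : 'I_s) st u v :
  dyck u -> closes st v -> closes st ((false, i) :: u ++ (true, i) :: v).
Proof.
move=> du; case: st => [|j st] /=; first exact: dyck_node.
move=> [u' [v' [du' -> cv']]].
exists ((false, i) :: u ++ (true, i) :: u'), v'.
by split=> //; [exact: dyck_node | rewrite /= -catA].
Qed.

Lemma balanced_closes s (st : seq 'I_s) w : balanced st w -> closes st w.
Proof.
elim: w st => [|[[] i] w IHw] st /=.
- by case: st => // _; apply: dyck_nil.
- case: st => //= j st /andP[/eqP-> /IHw cw].
  by exists [::], w; split=> //; apply: dyck_nil.
- by move=> /IHw /= [u [v [du -> cv]]]; apply: closes_node.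
Qed.

Lemma dyckP s (w : seq (paren s)) : dyck w <-> balanced [::] w.
Proof.
split=> [dw|/balanced_closes //].
by rewrite -[w]cats0 (balanced_dyck_cat _ _ dw).
Qed.

(** * Block encodings *)

Lemma balanced_open (T : eqType) (st v : seq T) w :
  balanced st (map (pair false) v ++ w) = balanced (rev v ++ st) w.
Proof. by elim: v st => //= i v IHv st; rewrite IHv rev_cons cat_rcons. Qed.

Lemma balanced_close (T : eqType) (st v v' : seq T) w : size v = size v' ->
  balanced (v ++ st) (map (pair true) v' ++ w) = (v == v') && balanced st w.
Proof.
elim: v v' => [|i v IHv] [|i' v'] //= [/IHv ->].
by rewrite eqseq_cons andbA.
Qed.

Definition block (I T : Type) (e : I -> seq T) (a : bool * I) : seq (bool * T) :=
  if a.1 then map (pair true) (rev (e a.2)) else map (pair false) (e a.2).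

(** Positive code length serves twice: a type still pending at the end leaves symbols pending, and a
    closing block met on an empty stack has a first letter that fails. *)
Lemma balanced_blocks (I T : eqType) (e : I -> seq T) l st (w : seq (bool * I)) :
    injective e -> (forall i, size (e i) = l.+1) ->
  balanced (flatten [seq rev (e i) | i <- st]) (flatten (map (block e) w))
    = balanced st w.
Proof.
move=> inj_e size_e; elim: w st => [|[[] i] w IHw] st; rewrite /= /block /= -/(block e).
- by case: st => //= i st; rewrite /nilp size_cat size_rev size_e.
- case: st => [|j st] /=.
    by move: (size_rev (e i)); rewrite size_e; case: (rev (e i)).
  rewrite balanced_close ?size_rev ?size_e // IHw.
  by rewrite (inj_eq (can_inj revK)) (inj_eq inj_e).
- by rewrite balanced_open -(IHw (i :: st)).
Qed.

(** * Running machines *)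

Lemma tape_space_act a t : tape_space (tape_act a t) <= (tape_space t).+1.
Proof.
by case: a t => c [] [[|x l] y [|z r]]; rewrite /tape_space /=; lia.
Qed.

(* A step visits at most one new cell on each tape, hence a time bound is also
   a space bound. *)
Lemma config_space_iter M w i :
  config_space (iter i (@step M) (start_config M w)) <= tapes M * i.+1.
Proof.
have sum1 : \sum_(j < tapes M) 1 = tapes M by rewrite sum1_card card_ord.
elim: i => [|i IHi].
  by rewrite muln1 -[leqRHS]sum1; apply: leq_sum => j _; rewrite ffunE.
rewrite iterS; move: (iter i _ _) IHi => c IHc.
apply: (@leq_trans (tapes M + config_space c)); last by rewrite mulnS leq_add2l.
rewrite /step; case: (next_action c) => [a|]; last exact: leq_addl.
rewrite -[X in X + _]sum1 /config_space /= -big_split /=.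
by apply: leq_sum => j _; rewrite ffunE add1n tape_space_act.
Qed.

(** Only the final configuration has to be exhibited; [config_space_iter] bounds the space along the
    way. *)
Lemma computes_in_time M w u sp tm j (c := iter j (@step M) (start_config M w)) :
    j <= tm -> tapes M * tm.+1 <= sp -> halted c -> written c = u ->
  computes M w u sp tm.
Proof.
move=> le_j le_sp halt_c out_c; exists j; split=> // i le_i.
apply: leq_trans (config_space_iter M w i) (leq_trans _ le_sp).
by rewrite leq_mul2l ltnS (leq_trans le_i le_j) orbT.
Qed.

Definition copier : machine :=
  @Machine unit tt 0
    (fun _ c _ => omap (fun b => Action tt true (Some b) (fun=> (None, Stay))) c).

Lemma copier_computes b sp tm : 0 < tm -> computes copier [:: b] [:: b] sp tm.
Proof. by move=> tm_gt0; apply: (@computes_in_time _ _ _ _ _ 1). Qed.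

(** * The encoding machine *)

Inductive enc_state := Start | OpenBit | OpenNext | Store | CloseBit | CloseNext.

Definition enc_state_code (q : enc_state) : 'I_6 :=
  inord match q with
        | Start => 0 | OpenBit => 1 | OpenNext => 2
        | Store => 3 | CloseBit => 4 | CloseNext => 5
        end.

Definition enc_state_decode (k : 'I_6) : enc_state :=
  nth Start [:: Start; OpenBit; OpenNext; Store; CloseBit; CloseNext] k.

Lemma enc_state_codeK : cancel enc_state_code enc_state_decode.
Proof. by case; rewrite /enc_state_decode /enc_state_code inordK. Qed.

HB.instance Definition _ := Countable.copy enc_state (can_type enc_state_codeK).
HB.instance Definition _ : isFinite enc_state := CanIsFinite enc_state_codeK.

(* Each letter of a block is written as its direction followed by its type bit;
   the direction is emitted in [Start], [OpenNext] and [CloseNext]. An empty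
   code ([s = 1]) is read as the single bit [false], which is what the default
   values in [OpenBit] and [CloseBit] produce. *)
Definition enc_trans (q : enc_state) (c w : option bool) :
    option (enc_state * bool * option bool * (option bool * move)) :=
  match q with
  | Start =>
      omap (fun b => (if b then Store else OpenBit, true, Some b, (w, Stay))) c
  | OpenBit => Some (OpenNext, true, Some (odflt false c), (w, Stay))
  | OpenNext => omap (fun=> (OpenBit, false, Some false, (w, Stay))) c
  | Store =>
      if c is Some b then Some (Store, true, None, (Some b, MoveRight))
      else Some (CloseBit, false, None, (w, MoveLeft))
  | CloseBit => Some (CloseNext, false, Some (odflt false w), (w, MoveLeft))
  | CloseNext => omap (fun=> (CloseBit, false, Some true, (w, Stay))) w
  end.

Definition encoder : machine :=
  @Machine enc_state Start 1
    (fun q c w =>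
       omap (fun r => let: (q', adv, em, a) := r in Action q' adv em (fun=> a))
            (enc_trans q c (w ord0))).

Definition enc_config q inp out t : config encoder :=
  @Config encoder q inp out [ffun=> t].

Lemma step_enc q inp out t :
  step (enc_config q inp out t) =
    if enc_trans q (ohead inp) (cur t) is Some (q', adv, em, a) then
      enc_config q' (if adv then behead inp else inp)
                 (if em is Some b then rcons out b else out) (tape_act a t)
    else enc_config q inp out t.
Proof.
rewrite /step /next_action /= !ffunE.
case: (enc_trans _ _ _) => [[[[q' adv] em] a]|] //=; congr Config.
by apply/ffunP => i; rewrite !ffunE.
Qed.

Definition letters (d : bool) (cs : seq bool) : seq bool :=
  flatten [seq [:: d; c] | c <- cs].

(** The first bit costs one step, its direction being already written by [Start]; each later bit
    costs two. *)
Lemma run_open cs c out t :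
  iter (2 * size cs).+1 (@step encoder) (enc_config OpenBit (c :: cs) out t)
    = enc_config OpenNext [::] (out ++ c :: letters false cs) t.
Proof.
case: t => l y r; elim: cs c out => [|c' cs IHcs] c out.
  by rewrite iterSr step_enc /= cats1.
rewrite mulnS 2!iterSr step_enc /= step_enc /=; rewrite /= in IHcs; rewrite IHcs.
by rewrite -!cats1 -!catA.
Qed.

Lemma run_store cs out l :
  iter (size cs) (@step encoder) (enc_config Store cs out (Tape l None [::]))
    = enc_config Store [::] out (Tape (rev (map Some cs) ++ l) None [::]).
Proof.
elim: cs l => [|c cs IHcs] l //.
by rewrite [size _]/= iterSr step_enc /= IHcs rev_cons cat_rcons.
Qed.

(** Here [cs] is in emission order, read leftwards from the head; the blank beyond it ends the run.
    Using [head] and [behead] covers an exhausted code too. *)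
Lemma run_close cs out r (l := map Some cs) : exists r',
  iter (2 * size cs) (@step encoder)
       (enc_config CloseNext [::] out (Tape (behead l) (head None l) r))
    = enc_config CloseNext [::] (out ++ letters true cs) (Tape [::] None r').
Proof.
rewrite {}/l; elim: cs out r => [|c cs IHcs] out r; first by exists r; rewrite cats0.
have [r' run_cs] := IHcs (rcons (rcons out true) c) (Some c :: r).
exists r'; rewrite mulnS 2!iterSr step_enc /= step_enc /= run_cs.
by rewrite -!cats1 -!catA.
Qed.

Lemma encoder_computes d cs sp tm (cs' := if cs is [::] then [:: false] else cs) :
    3 * size cs + 3 <= tm -> tm < sp ->
  computes encoder (d :: cs) (letters d (if d then rev cs' else cs')) sp tm.
Proof.
move=> le_tm lt_sp.
have enc_start : start_config encoder (d :: cs)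
    = enc_config Start (d :: cs) [::] blank_tape by [].
(* [OpenNext] halts because the input is exhausted, [CloseNext] only on a blank cell. *)
suff [j [t [le_j run_j halt_t]]] : exists j t, [/\ j <= tm,
    iter j (@step encoder) (start_config encoder (d :: cs))
      = enc_config (if d then CloseNext else OpenNext) [::]
                   (letters d (if d then rev cs' else cs')) t
  & d -> cur t = None].
  apply: (computes_in_time le_j); rewrite ?mul1n // run_j //.
  rewrite /halted /next_action /= ffunE ffunE.
  by case: (d) halt_t => //= ->.
rewrite enc_start; case: d {enc_start} => /=; last first.
  exists (2 * (size cs).-1).+2, blank_tape; split=> //; first lia.
  rewrite iterSr step_enc {}/cs'.
  by case: cs {le_tm} => [|c cs]; [rewrite muln0 /= step_enc | apply: run_open].
pose bs := rev cs.
(* The first emitted bit is treated apart, since [Start] writes its direction. The two cells to the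
   right are the one just read and the blank where storing stopped. *)
have [r' run_bs] := run_close (behead bs)
  [:: true; head false bs] [:: ohead bs; None].
exists ((2 * size (behead bs)).+2 + (size cs).+1), (Tape [::] None r').
split=> //; first by rewrite size_behead size_rev; lia.
rewrite iterD 2!iterSr [iter (size cs).+1 _ _]iterSr step_enc /= run_store.
rewrite cats0 -map_rev -/bs step_enc /= step_enc /=.
have -> : head None (map Some bs) = ohead bs by case: (bs).
have -> : odflt false (ohead bs) = head false bs by case: (bs).
(* For empty [cs] the default of [head] supplies the single bit [false] of [cs']. *)
have -> : rev cs' = head false bs :: behead bs.
  rewrite /cs' /bs; case/lastP: (cs) => // s c.
  by rewrite rev_rcons; case: s => // c' s; rewrite -[RHS]rev_rcons.
by rewrite -!behead_map in run_bs *.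
Qed.

(** * Binary codes of parentheses *)

Definition ord_bool (b : bool) : 'I_2 := inord b.

Lemma val_ord_bool b : ord_bool b = b :> nat.
Proof. by rewrite inordK //; case: b. Qed.

Lemma ord_bool_inj : injective ord_bool.
Proof. by move=> b c /(congr1 val) /=; rewrite !val_ord_bool; case: b c => [] []. Qed.

Definition type_code s (i : 'I_s) : seq 'I_2 :=
  map ord_bool (bits (block_length s) i).

Lemma size_type_code s (i : 'I_s) : size (type_code i) = block_length s.
Proof. by rewrite size_map size_mkseq. Qed.

Lemma type_code_inj s : injective (@type_code s).
Proof.
move=> i j /(inj_map ord_bool_inj) eq_bits; apply: val_inj.
have lt_s (k : 'I_s) : k < 2 ^ block_length s.
  apply: leq_trans (ltn_ord k) (leq_trans (@up_logP 2 s isT) _).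
  by rewrite leq_exp2l // leq_maxr.
exact: bits_inj eq_bits.
Qed.

(** An empty code forces [i = 0], whose one-bit expansion is the default produced by the encoder. *)
Lemma bits_block_length s (i : 'I_s) : bits (block_length s) i =
  if bits (up_log 2 s) i is [::] then [:: false] else bits (up_log 2 s) i.
Proof.
rewrite /block_length; case E: (up_log 2 s) => [|w]; last by rewrite (maxn_idPr _).
have := leq_trans (ltn_ord i) (@up_logP 2 s isT).
by rewrite E expn0 ltnS leqn0 => /eqP->.
Qed.

Lemma code_word_block s (a : paren s) (bs := bits (block_length s) a.2) :
  code_word (P := DYCK 2) (block (@type_code s) a)
    = letters a.1 (if a.1 then rev bs else bs).
Proof.
have code2 d v : code_word (P := DYCK 2) (map (pair d) (map ord_bool v)) = letters d v.
  rewrite /code_word /letters -!map_comp; congr flatten; apply: eq_map => b /=.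
  by rewrite (_ : up_log 2 2 = 1) // /bits /mkseq /= val_ord_bool divn1 oddb.
by rewrite /block /type_code /bs; case: a.1 => /=; rewrite -?map_rev code2.
Qed.

Lemma size_block s (a : paren s) :
  size (block (@type_code s) a) == block_length s.
Proof.
by rewrite /block; case: a.1; rewrite size_map ?size_rev size_type_code.
Qed.

Lemma dyck_blocks s (w : seq (paren s)) :
  dyck (flatten (map (block (@type_code s)) w)) <-> dyck w.
Proof.
rewrite !dyckP.
rewrite -(@balanced_blocks _ _ _ (block_length s).-1 [::] w (@type_code_inj s)) //.
by move=> i; rewrite size_type_code prednK // leq_maxl.
Qed.

Theorem proposition1 :
  exists (M N : machine) (space time : nat -> nat),
    [/\ bigO space (up_log 2),
        bigO time (up_log 2)
      & forall s : nat, 1 <= s ->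
          streaming_reduction M N (DYCK s) (DYCK 2)
            (fun=> block_length s) (fun=> space s) (fun=> time s)].
Proof.
(* Space exceeds time by one because the encoder's single tape starts with one visited cell. *)
exists encoder, copier,
  (fun s => 3 * up_log 2 s + 4), (fun s => 3 * up_log 2 s + 3).
have log_gt0 s : 1 < s -> 0 < up_log 2 s by rewrite up_log_gt0.
(* From [s = 2] on the logarithm is at least 1 and absorbs the additive constants: 3 + 4 = 7 and 3 +
   3 = 6. *)
split; [exists 7, 2 => s /log_gt0 | exists 6, 2 => s /log_gt0 |]; try lia.
move=> s _ n x; exists (map_tuple (fun a => Tuple (size_block a)) x); split=> [i|b].
  rewrite tnth_map code_word_block bits_block_length.
  by apply: encoder_computes; rewrite ?size_mkseq //; lia.
rewrite /is_solution /= -map_comp dyck_blocks => sol_b.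
by exists b => //; apply: copier_computes; rewrite addn3.
Qed.
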